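(* Let $T$ be a strong tournament of order $n$ and diameter $d\ge 6$. If $\Omega_v(T)\le 2d-6$, then $$smc_v(T)=n-\Omega_v(T)+1.$$
   Context: A tournament is an orientation of a complete graph. All paths are directed. A digraph is strong (strongly connected) if for every pair of vertices $u,v$, each is reachable from the other. The diameter is the maximum of the directed distances $d(u,v)$ over ordered pairs of vertices. A set $S$ of vertices of a digraph $D$ is a dominating set if for each $v\in V(D)\setminus S$ there is $u\in S$ with $u\to v$; it is an absorbing set if for each $v\in V(D)\setminus S$ there is $u\in S$ with $v\to u$. A subdigraph $H$ of $D$ is dominating (absorbing) if $V(H)$ is a dominating (absorbing) set of $D$. $\Omega_v(D)$ denotes the minimum order (number of vertices) of an absorbing, dominating and strong subdigraph of $D$. A directed path in a vertex-colored digraph is vertex-monochromatic if all its internal vertices have the same color (so paths with at most one internal vertex are always vertex-monochromatic). A vertex-coloring (not necessarily proper) of a strong digraph is an SVMC-coloring if for every pair $u,v$ of vertices there exist a directed $(u,v)$-vertex-monochromatic path and a directed $(v,u)$-vertex-monochromatic path. $smc_v(D)$ denotes the maximum number of colors used in an SVMC-coloring of the strong digraph $D$. *)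

(* Defs.v *)
(* Mathematical Components; a finite digraph is a relation e : rel V on a
   finType V, with e x y meaning x -> y. *)
From mathcomp Require Import all_boot.

Set Implicit Arguments.
Unset Strict Implicit.
Unset Printing Implicit Defensive.

Definition tournament (V : finType) (e : rel V) : Prop :=
  irreflexive e /\ forall x y : V, x != y -> e x y (+) e y x.

Definition strong (V : finType) (e : rel V) : bool :=
  [forall u, forall v, connect e u v].

(* The directed path u :: p, of length size p, from u to v.  For u = v it is
   the trivial path. *)
Definition dipath (V : finType) (e : rel V) (u v : V) (p : seq V) : bool :=
  [&& path e u p, last u p == v & uniq (u :: p)].

(* As paths do not repeat vertices, their lengths are < #|V|.  The value is the
   junk #|V| when v is not reachable from u; this never happens in a strong
   digraph. *)
Definition dist (V : finType) (e : rel V) (u v : V) : nat :=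
  \big[minn/#|V|]_(k < #|V| | [exists p : k.-tuple V, dipath e u v p]) k.

Definition diameter (V : finType) (e : rel V) : nat :=
  \max_(u : V) \max_(v : V) dist e u v.

Definition dominating (V : finType) (e : rel V) (S : {set V}) : bool :=
  [forall v in ~: S, exists u in S, e u v].

Definition absorbing (V : finType) (e : rel V) (S : {set V}) : bool :=
  [forall v in ~: S, exists u in S, e v u].

(* H = (vertex set, arc set); a subdigraph need not be induced. *)
Definition subdigraph (V : finType) (e : rel V)
    (H : {set V} * {set V * V}) : bool :=
  [forall a in H.2, [&& e a.1 a.2, a.1 \in H.1 & a.2 \in H.1]].

(* Reachability inside H: every walk along arcs of H that starts in H.1 stays
   in H.1 when H is a subdigraph. *)
Definition strong_sub (V : finType) (H : {set V} * {set V * V}) : bool :=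
  [forall u in H.1, forall v in H.1, connect (fun x y => (x, y) \in H.2) u v].

(* In a strong digraph the minimum is over a nonempty family (the digraph
   itself belongs to it), so the default value #|V| plays no role. *)
Definition Omega_v (V : finType) (e : rel V) : nat :=
  \big[minn/#|V|]_(H : {set V} * {set V * V} |
      [&& subdigraph e H, strong_sub H, dominating e H.1 & absorbing e H.1])
    #|H.1|.

(* The vertices of the path u :: p other than its two ends. *)
Definition internal (V : finType) (u : V) (p : seq V) : seq V :=
  behead (belast u p).

Definition vertex_monochromatic (V : finType) (C : eqType) (c : V -> C)
    (u : V) (p : seq V) : bool :=
  constant [seq c x | x <- internal u p].

Definition vm_reachable (V : finType) (C : eqType) (e : rel V) (c : V -> C)
    (u v : V) : bool :=
  [exists k : 'I_#|V|, exists p : k.-tuple V,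
    dipath e u v p && vertex_monochromatic c u p].

(* The length bound in vm_reachable is harmless. *)
Lemma vm_reachableP (V : finType) (C : eqType) (e : rel V) (c : V -> C)
    (u v : V) :
  reflect (exists p : seq V, dipath e u v p && vertex_monochromatic c u p)
          (vm_reachable e c u v).
Proof.
apply: (iffP existsP) => [[k /existsP [p Hp]]|[p Hp]]; first by exists p.
have ltp : size p < #|V|.
  by case/andP: Hp => /and3P [_ _ /card_uniqP /= sz_p] _; rewrite -sz_p max_card.
by exists (Ordinal ltp); apply/existsP; exists (in_tuple p).
Qed.

Definition SVMC_coloring (V : finType) (C : eqType) (e : rel V)
    (c : V -> C) : bool :=
  [forall u, forall v, vm_reachable e c u v && vm_reachable e c v u].

(* A coloring of V uses at most #|V| colors, so the palette 'I_#|V| suffices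
   and only the number of colors actually used is counted. *)
Definition smc_v (V : finType) (e : rel V) : nat :=
  \max_(c : {ffun V -> 'I_#|V|} | SVMC_coloring e c) #|[set c x | x : V]|.

(* Main.v *)
Require Import Defs.
From mathcomp Require Import all_boot zify.

Set Implicit Arguments.
Unset Strict Implicit.
Unset Printing Implicit Defensive.

(** Lower bound: give one color to a minimum set S inducing a strong, dominating
    and absorbing subdigraph, and pairwise distinct colors to the other
    vertices. From any vertex one steps into S, travels inside S, and steps out
    to any other vertex, so all internal vertices have the color of S
    ([SVMC_of_set], [smc_v_ge]).

    Upper bound: fix a, b with d(a, b) = d and put l x = d(a, x), so that l
    grows by at most one along an arc; in a tournament, a vertex x whose layer
    is at least two above that of y therefore has the arc x -> y. Any
    vertex-monochromatic path whose ends are k >= 2 layers apart has at least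
    k - 1 internal vertices, all of the same color ([SVMC_segment],
    [segment_card]). Let p, ..., q be the internal vertices of such a path from
    a to b, let D be their color class, and let H be the strong component of p
    in the subdigraph induced by D; as q is far above p, the arc q -> p closes
    the path into a cycle, so q is in H.

    The set H is absorbing. Vertices of layer at least 3 have an arc to p.
    A vertex x of layer at most 2 has a monochromatic path to b with at least
    d - 3 internal vertices. If their color is not that of D, then D and this
    second class, having at least d - 1 and d - 3 members, leave at most
    n - (2d - 6) colors in all, which is below the bound because
    Omega_v <= 2d - 6. If it is that of D, the first internal vertex y has
    layer at most 3 <= d - 3 (as d >= 6), so q -> y, while the last one has an arc to p;
    hence y is in H and absorbs x. Domination is symmetric, with paths from a
    in place of paths to b. So H has at least Omega_v vertices, all of one
    color, which leaves at most n - Omega_v + 1 colors ([colors_le]). *)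

(** * Distances as layers *)

Lemma bigmin_le (I : finType) (P : pred I) (F : I -> nat) (m : nat) (i : I) :
  P i -> \big[minn/m]_(j | P j) F j <= F i.
Proof.
move=> Pi; elim: (index_enum I) (mem_index_enum i) => // j s IHs.
rewrite inE big_cons => /predU1P [<-|/IHs le_i]; first by rewrite Pi geq_minl.
by case: ifP => // _; rewrite geq_min le_i orbT.
Qed.

Lemma bigmin_attained (I : finType) (P : pred I) (F : I -> nat) (m : nat)
    (i0 : I) :
  P i0 -> (forall i, P i -> F i <= m) ->
  exists2 i, P i & \big[minn/m]_(j | P j) F j = F i.
Proof.
move=> Pi0 le_m; have [i Pi min_i] := arg_minnP F Pi0; exists i => //.
apply/eqP; rewrite eqn_leq bigmin_le //=.
elim/big_ind: _ => [|x y lex ley|j /min_i //]; first exact: le_m.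
by rewrite leq_min lex.
Qed.

Section Dist.
Variables (V : finType) (e : rel V).

Lemma uniq_cons_size (u : V) (p : seq V) : uniq (u :: p) -> size p < #|V|.
Proof. by move/card_uniqP => /= <-; exact: max_card. Qed.

(** Walks suffice: removing the loops of a walk only shortens it. *)
Lemma dist_le_walk (u : V) (p : seq V) :
  path e u p -> dist e u (last u p) <= size p.
Proof.
case/shortenP => q e_q uniq_q sub_qp.
have/andP [_ uniq_q'] := uniq_q; apply: leq_trans (uniq_leq_size uniq_q' sub_qp).
have ltq := uniq_cons_size uniq_q.
apply: (bigmin_le (fun k : 'I_#|V| => k : nat) _ (i := Ordinal ltq)).
by apply/existsP; exists (in_tuple q); rewrite /dipath e_q eqxx.
Qed.

Lemma dist_walk (u v : V) :
  connect e u v -> exists2 p, path e u p & v = last u p /\ size p = dist e u v.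
Proof.
case/connectP => p0 /shortenP [q e_q uniq_q _] ->.
have ltq := uniq_cons_size uniq_q.
have [|k _|k] := @bigmin_attained _
    (fun k : 'I_#|V| => [exists p : k.-tuple V, dipath e u (last u q) p])
    (fun k => k) #|V| (Ordinal ltq).
- by apply/existsP; exists (in_tuple q); rewrite /dipath e_q eqxx.
- exact: ltnW.
case/existsP=> p /and3P [e_p /eqP last_p _] def_k.
by exists p => //; split; [rewrite last_p | rewrite [LHS]size_tuple -def_k].
Qed.

Lemma dist_self (u : V) : dist e u u = 0.
Proof. by apply/eqP; rewrite -leqn0; exact: (dist_le_walk (p := [::])). Qed.

Lemma dist_arc (a x y : V) :
  connect e a x -> e x y -> dist e a y <= (dist e a x).+1.
Proof.
case/dist_walk=> p e_p [def_x <-] e_xy; rewrite -(size_rcons p y).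
have := @dist_le_walk a (rcons p y); rewrite last_rcons; apply.
by rewrite rcons_path e_p -def_x.
Qed.

Lemma diameter_attained : 0 < diameter e ->
  exists u v, dist e u v = diameter e.
Proof.
move=> d_gt0; case: (posnP #|V|) => [V0 | V_gt0].
  move: d_gt0; rewrite /diameter big_pred0 // => x.
  by have := card0_eq V0 x.
rewrite /diameter; have [u ->] := eq_bigmax (fun u => \max_(v : V) dist e u v) V_gt0.
have [v ->] := eq_bigmax (dist e u) V_gt0.
by exists u, v.
Qed.

End Dist.

(** * Vertex sets inducing strong, dominating and absorbing subdigraphs *)

Section Omega.
Variables (V : finType) (e : rel V).

Definition induced (S : {set V}) : rel V :=
  fun x y => [&& x \in S, y \in S & e x y].

(** It suffices to consider vertex sets: adding all arcs between the vertices
    of a subdigraph keeps it strong. *)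
Definition strong_set (S : {set V}) : Prop :=
  {in S &, forall u v, connect (induced S) u v}.

Lemma Omega_v_le (S : {set V}) :
  strong_set S -> dominating e S -> absorbing e S -> Omega_v e <= #|S|.
Proof.
move=> strS domS absS.
pose A := [set a : V * V | induced S a.1 a.2].
apply: (bigmin_le (fun H : {set V} * {set V * V} => #|H.1|) _ (i := (S, A))).
rewrite /= domS absS !andbT; apply/andP; split.
  by apply/forall_inP=> -[x y]; rewrite inE => /and3P [/= -> -> ->].
apply/forall_inP=> u uS; apply/forall_inP=> v vS.
rewrite (@eq_connect _ _ (induced S)); first exact: strS.
by move=> x y; rewrite inE.
Qed.

Lemma Omega_v_attained : strong e ->
  exists S : {set V},
    [/\ strong_set S, dominating e S, absorbing e S & #|S| = Omega_v e].
Proof.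
move=> str_e.
have [|H _|H] := @bigmin_attained _ (fun H : {set V} * {set V * V} =>
      [&& subdigraph e H, strong_sub H, dominating e H.1 & absorbing e H.1])
    (fun H => #|H.1|) #|V| (setT, [set a : V * V | e a.1 a.2]).
- apply/and4P; split; apply/forall_inP => /=.
  + by move=> a; rewrite !inE => ->.
  + move=> u _; apply/forall_inP=> v _.
    rewrite (@eq_connect _ _ e); first by move/forallP/(_ u)/forallP: str_e.
    by move=> x y; rewrite inE.
  + by move=> x; rewrite !inE.
  + by move=> x; rewrite !inE.
- exact: max_card.
case/and4P=> /forall_inP subH /forall_inP strH domH absH def_Omega.
exists H.1; split=> // u v uH vH; move/forall_inP/(_ v vH): (strH u uH).
apply: connect_sub => x y /subH /and3P [/= exy xH yH].
by apply: connect1; rewrite /induced xH yH.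
Qed.

Definition strong_component (C : {set V}) (p : V) : {set V} :=
  [set z in C | connect (induced C) z p && connect (induced C) p z].

(** Every vertex on a walk between two vertices of the component lies in the
    component, so reachability in [C] descends to reachability in the component
    itself. *)
Lemma strong_component_strong (C : {set V}) (p : V) :
  strong_set (strong_component C p).
Proof.
set H := strong_component C p => u v uH vH.
have /connectP [s] : connect (induced C) u v.
  move: uH vH; rewrite !inE => /and3P [_ u_p _] /and3P [_ _].
  exact: connect_trans u_p.
elim: s u uH => [|w s IHs] u uH /=; first by move=> _ ->.
case/andP=> /and3P [uC wC e_uw] path_s def_v.
have wH : w \in H.
  move: uH vH; rewrite !inE wC => /and3P [_ _ p_u] /and3P [_ v_p _].
  rewrite andTb; apply/andP; split.
    by apply: connect_trans v_p; apply/connectP; exists s.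
  by apply: connect_trans p_u (connect1 _); rewrite /induced uC wC.
apply: connect_trans (IHs w wH path_s def_v).
by apply: connect1; rewrite /induced uH wH.
Qed.

End Omega.

(** * Colorings from strong, dominating and absorbing sets *)

Section Lower.
Variables (V : finType) (e : rel V).

Lemma vm_internal_in (C : eqType) (c : V -> C) (S : {set V}) (u : V)
    (p : seq V) :
  {in S &, forall x y, c x = c y} -> {subset internal u p <= S} ->
  vertex_monochromatic c u p.
Proof.
move=> cS; rewrite /vertex_monochromatic; case: (internal u p) => //= x s sS.
rewrite all_map; apply/allP=> y ys /=; apply/eqP.
by apply: cS; apply: sS; rewrite !inE ?ys ?eqxx ?orbT.
Qed.

Lemma induced_path (S : {set V}) (u : V) (p : seq V) :
  path (induced e S) u p -> path e u p && all (mem S) p.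
Proof.
elim: p u => //= v p IHp u /andP [/and3P [_ -> ->] /IHp /andP [-> ->]] //.
Qed.

(** A path between two vertices can be taken with all its internal vertices
    in [S]: an arc into [S], a path inside [S], and an arc out of [S]. *)
Lemma SVMC_of_set (C : eqType) (c : V -> C) (S : {set V}) :
  strong_set e S -> dominating e S -> absorbing e S ->
  {in S &, forall x y, c x = c y} -> SVMC_coloring e c.
Proof.
move=> strS /forall_inP domS /forall_inP absS cS.
have internal_sub (u : V) p : {subset internal u p <= belast u p}.
  by move=> z; rewrite /internal; apply: mem_behead.
have inS (u v : V) : v \in S -> exists2 p, dipath e u v p & {subset p <= S}.
  move=> vS; have [uS|uS] := boolP (u \in S).
    have /connectP [p0 /shortenP [p e_p uniq_p _] ->] := strS u v uS vS.
    have /andP [path_p /allP pS] := induced_path e_p.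
    by exists p; rewrite // /dipath path_p eqxx.
  have /exists_inP [w wS e_uw] : [exists w in S, e u w] by apply: absS; rewrite inE.
  have /connectP [p0 /shortenP [p e_p uniq_p _] ->] := strS w v wS vS.
  have /andP [path_p /allP pS] := induced_path e_p.
  have wpS : {subset w :: p <= S} by move=> z /predU1P [->|/pS].
  exists (w :: p) => //; rewrite /dipath /= e_uw path_p eqxx /=.
  by rewrite [_ && uniq p]uniq_p andbT; apply: contra uS => /wpS.
have reach u v : vm_reachable e c u v.
  apply/vm_reachableP.
  have [<-|neq_uv] := eqVneq u v; first by exists [::]; rewrite /dipath /= eqxx.
  have [vS|vS] := boolP (v \in S).
    have [p dip pS] := inS u v vS; exists p; rewrite dip.
    apply: (vm_internal_in cS) => z.
    case: (p) pS => [|w s] sS //; rewrite /internal /= => zs.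
    by apply: sS; apply: mem_belast.
  have /exists_inP [w wS e_wv] : [exists w in S, e w v] by apply: domS; rewrite inE.
  have [p /and3P [e_p /eqP last_p uniq_p] pS] := inS u w wS.
  exists (rcons p v); apply/andP; split.
    rewrite /dipath rcons_path e_p last_p e_wv last_rcons eqxx.
    rewrite !andTb -rcons_cons rcons_uniq uniq_p andbT inE negb_or eq_sym neq_uv.
    by apply: contra vS => /pS.
  by apply: (vm_internal_in cS); rewrite /internal belast_rcons.
by apply/forallP=> u; apply/forallP=> v; rewrite !reach.
Qed.

Lemma smc_v_ge (S : {set V}) :
  strong_set e S -> dominating e S -> absorbing e S -> 0 < #|S| ->
  #|V| - #|S| + 1 <= smc_v e.
Proof.
move=> strS domS absS /card_gt0P [h hS].
(* The colors are the vertices themselves, h being the color shared by S. *)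
pose c := [ffun x => enum_rank (if x \in S then h else x)].
have svmc : SVMC_coloring e c.
  by apply: (SVMC_of_set strS domS absS) => x y; rewrite !ffunE => -> ->.
apply: leq_trans (leq_bigmax_cond _ svmc).
have -> : [set c x | x : V] = enum_rank @: (h |: ~: S).
  apply/setP=> i; apply/imsetP/imsetP => -[x].
    move=> _ ->; rewrite ffunE; exists (if x \in S then h else x) => //.
    by rewrite !inE; case: ifP => [_|->]; rewrite ?eqxx ?orbT.
  move=> xS ->; exists x => //; rewrite ffunE.
  by move: xS; rewrite !inE; case/predU1P => [->|/negPf ->] //; rewrite hS.
rewrite card_imset; last exact: enum_rank_inj.
by rewrite cardsU1 inE hS [#|~: S|]cardsCs setCK addnC.
Qed.

End Lower.

(** * Counting the colors *)

Lemma card_colors_le (V C : finType) (c : V -> C) (A : {set V}) :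
  #|[set c x | x : V]| + #|A| <= #|c @: A| + #|V|.
Proof.
rewrite -(cardsC A) [X in X <= _]addnC [X in _ <= X]addnCA leq_add2l.
apply: leq_trans (leq_add (leqnn _) (leq_imset_card c (~: A))).
apply: leq_trans (leq_card_setU _ _); apply: subset_leq_card.
apply/subsetP=> _ /imsetP [x _ ->]; rewrite inE.
apply/orP; have [xA|xA] := boolP (x \in A); [left | right]; rewrite imset_f //.
by rewrite inE.
Qed.

Lemma card_colors_le1 (V C : finType) (c : V -> C) (k : C) (A : {set V}) :
  {in A, forall x, c x = k} -> #|[set c x | x : V]| + #|A| <= #|V| + 1.
Proof.
move=> cA; apply: leq_trans (card_colors_le c A) _.
rewrite addnC leq_add2l -(cards1 k); apply: subset_leq_card.
by apply/subsetP=> _ /imsetP [x xA ->]; rewrite inE cA.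
Qed.

Lemma card_colors_le2 (V C : finType) (c : V -> C) (k1 k2 : C)
    (A1 A2 : {set V}) :
  k1 != k2 -> {in A1, forall x, c x = k1} -> {in A2, forall x, c x = k2} ->
  #|[set c x | x : V]| + (#|A1| + #|A2|) <= #|V| + 2.
Proof.
move=> neq_k cA1 cA2.
have -> : #|A1| + #|A2| = #|A1 :|: A2|.
  rewrite cardsU disjoint_setI0 ?cards0 ?subn0 //; apply/pred0P=> x /=.
  apply/negbTE/negP=> /andP [xA1 xA2].
  by rewrite -(cA1 x xA1) (cA2 x xA2) eqxx in neq_k.
apply: leq_trans (card_colors_le c _) _; rewrite addnC leq_add2l.
have <- : #|[set k1; k2]| = 2 by rewrite cards2 neq_k.
apply: subset_leq_card; apply/subsetP=> _ /imsetP [x xA ->].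
by move: xA; rewrite !inE => /orP [/cA1|/cA2] ->; rewrite eqxx ?orbT.
Qed.

(** * Monochromatic segments *)

Section Segment.
Variables (V : finType) (C : eqType) (e : rel V) (c : V -> C).

(** The path u, y, s, v has at least one internal vertex, and [y :: s] is the
    list of its internal vertices. The color of [y] serves as the common one. *)
Definition mono_segment (u v y : V) (s : seq V) : bool :=
  [&& e u y, path e y s, e (last y s) v, uniq (y :: s) &
      all (fun z => c z == c y) s].

(** The only property of the distance from a fixed vertex that matters is that
    it grows by at most one along an arc. *)
Variable l : V -> nat.
Hypothesis l_arc : forall x y, e x y -> l y <= (l x).+1.

Lemma layer_path (u : V) (p : seq V) : path e u p -> l (last u p) <= l u + size p.
Proof.
elim: p u => [|v p IHp] u /=; first by rewrite addn0.
by case/andP=> /l_arc e_uv /IHp; lia.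
Qed.

(** Two layers of difference exclude paths with no internal vertex. *)
Lemma SVMC_segment (u v : V) : SVMC_coloring e c -> l u + 2 <= l v ->
  exists y s, mono_segment u v y s.
Proof.
move=> /forallP/(_ u)/forallP/(_ v)/andP [/vm_reachableP [p] + _] l_uv.
case/andP=> /and3P [e_p /eqP last_p uniq_p] mono_p.
have := layer_path e_p; rewrite last_p.
case/lastP: p e_p last_p uniq_p mono_p => [|[|y s] w] //=; rewrite ?last_rcons.
- by lia.
- by lia.
rewrite rcons_path => /and3P [e_uy e_s e_w] <- uniq_p mono_p _.
exists y, s; rewrite /mono_segment e_uy e_s e_w.
case/andP: uniq_p => _; rewrite -[_ && _]/(uniq (rcons (y :: s) w)).
rewrite rcons_uniq => /andP [_ ->] /=.
move: mono_p; rewrite /vertex_monochromatic /internal /= belast_rcons /=.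
by rewrite all_map.
Qed.

Lemma segment_color (u v y : V) (s : seq V) : mono_segment u v y s ->
  {in [set z in y :: s], forall z, c z = c y}.
Proof.
case/and5P=> _ _ _ _ /allP same z; rewrite !inE.
by case/predU1P=> [-> // | /same /eqP].
Qed.

Lemma segment_card (u v y : V) (s : seq V) : mono_segment u v y s ->
  l v <= l u + #|[set z in y :: s]| + 1.
Proof.
case/and5P=> e_uy e_s e_v uniq_s _.
rewrite cardsE (card_uniqP uniq_s) /=.
have := l_arc e_uy; have := layer_path e_s; have := l_arc e_v; lia.
Qed.

Lemma segment_connect (u v y : V) (s : seq V) (D : {set V}) :
  mono_segment u v y s -> [set z | c z == c y] \subset D ->
  connect (induced e D) y (last y s).
Proof.
case/and5P=> _ e_s _ _ same sub_D; apply/connectP; exists s => //.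
have yD : y \in D by apply: (subsetP sub_D); rewrite inE.
have sD : all (mem D) s.
  by apply: sub_all same => z cz; apply: (subsetP sub_D); rewrite inE.
elim: s y e_s yD sD {same sub_D} => //= z s IHs y /andP [e_yz e_s] yD.
by case/andP=> zD sD; rewrite /induced yD zD e_yz IHs.
Qed.

End Segment.

(** * The upper bound *)

Section Upper.
Variables (V C : finType) (e : rel V) (c : V -> C).
Hypotheses (tour_e : tournament e) (svmc : SVMC_coloring e c).

(** If the bound failed, no second color could occur on a path climbing at
    least d - 2 layers; the strong component of the class of the path from [a]
    to [b] would then be dominating and absorbing, hence have at least
    [Omega_v e] vertices of a single color, which gives the bound after all. *)
Lemma colors_le (l : V -> nat) (a b : V) (d : nat) :
  (forall x y, e x y -> l y <= (l x).+1) ->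
  l a = 0 -> l b = d -> 6 <= d -> Omega_v e <= 2 * d - 6 ->
  #|[set c x | x : V]| + Omega_v e <= #|V| + 1.
Proof.
move=> l_arc la lb d_ge6 Omega_le.
have back x y : l x + 2 <= l y -> e y x.
  move=> l_xy; have neq_xy : x != y by apply: contraTneq l_xy => ->; lia.
  have := tour_e.2 x y neq_xy.
  by have [/l_arc|_ //] := boolP (e x y); lia.
case: leqP => // large.
have [p [s seg]] : exists p s, mono_segment e c a b p s.
  by apply: (SVMC_segment l_arc) => //; lia.
have lp : l p <= 1 by case/and5P: (seg) => /l_arc; lia.
have lq : d <= (l (last p s)).+1 by case/and5P: (seg) => _ _ /l_arc; lia.
pose D := [set z | c z == c p].
(* Classes with d - 1 and d - 3 members leave at most #|V| + 2 - (2 * d - 4)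
   colors, against the failure of the bound. *)
have long_segment u v y t :
    l u + d <= l v + 2 -> mono_segment e c u v y t -> c y = c p.
  move=> l_uv seg'; apply/eqP/negPn/negP=> neq_c.
  have := card_colors_le2 neq_c (segment_color seg') (segment_color seg).
  by have := segment_card l_arc seg; have := segment_card l_arc seg'; lia.
have inD u v y t : l u + d <= l v + 2 -> mono_segment e c u v y t ->
    [/\ y \in D, last y t \in D & connect (induced e D) y (last y t)].
  move=> l_uv seg'; have cy := long_segment _ _ _ _ l_uv seg'; split.
  - by rewrite inE cy.
  - by rewrite inE -cy (segment_color seg') // inE mem_last.
  - by apply: (segment_connect seg'); rewrite cy.
have [|pD qD p_q] := inD _ _ _ _ _ seg; first by lia.
set q := last p s in lq qD p_q.
have to_p z : z \in D -> 3 <= l z -> connect (induced e D) z p.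
  by move=> zD lz; apply: connect1; rewrite /induced zD pD back //; lia.
have from_p z : z \in D -> l z <= d - 3 -> connect (induced e D) p z.
  move=> zD lz; apply: connect_trans p_q (connect1 _).
  by rewrite /induced zD qD back //; lia.
pose H := strong_component e D p.
have pH : p \in H by rewrite inE pD !connect0.
have qH : q \in H by rewrite inE qD p_q to_p //; lia.
(* A low vertex is absorbed by the first internal vertex of a path to b. *)
have absH : absorbing e H.
  apply/forall_inP=> x _; apply/exists_inP.
  have [lx|lx] := leqP 3 (l x); first by exists p => //; apply: back; lia.
  have [y [t seg']] : exists y t, mono_segment e c x b y t.
    by apply: (SVMC_segment l_arc) => //; lia.
  case/and5P: (seg') => e_xy _ /l_arc l_t _ _.
  have [|yD tD y_t] := inD _ _ _ _ _ seg'; first by lia.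
  exists y => //; rewrite inE yD from_p //; last by have := l_arc _ _ e_xy; lia.
  by rewrite (connect_trans y_t) // to_p //; lia.
(* A high vertex is dominated by the last internal vertex of a path from a. *)
have domH : dominating e H.
  apply/forall_inP=> x _; apply/exists_inP.
  have [lx|lx] := leqP (l x) (d - 3); first by exists q => //; apply: back; lia.
  have [y [t seg']] : exists y t, mono_segment e c a x y t.
    by apply: (SVMC_segment l_arc) => //; lia.
  case/and5P: (seg') => /l_arc l_y _ e_tx _ _.
  have [|yD tD y_t] := inD _ _ _ _ _ seg'; first by lia.
  exists (last y t) => //; rewrite inE tD to_p //=; last first.
    by have := l_arc _ _ e_tx; lia.
  by apply: connect_trans y_t; apply: from_p => //; lia.
have cH : {in H, forall x, c x = c p} by move=> x; rewrite !inE => /andP [/eqP].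
have := card_colors_le1 cH.
have := Omega_v_le (@strong_component_strong _ e D p) domH absH; rewrite -/H; lia.
Qed.

End Upper.

(** * The theorem *)

Theorem theorem6 (V : finType) (e : rel V) (n d : nat)
    (tour_e : tournament e) (strong_e : strong e)
    (order_e : #|V| = n) (diam_e : diameter e = d) (d_ge6 : 6 <= d)
    (Omega_le : Omega_v e <= 2 * d - 6) :
  smc_v e = n - Omega_v e + 1.
Proof.
have [|a [b d_ab]] := @diameter_attained _ e; first by lia.
have [S [strS domS absS card_S]] := Omega_v_attained strong_e.
have S_gt0 : 0 < #|S|.
  have [aS|aS] := boolP (a \in S); first by apply/card_gt0P; exists a.
  have /exists_inP [x xS _] : [exists x in S, e x a].
    by move/forall_inP: domS; apply; rewrite inE.
  by apply/card_gt0P; exists x.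
apply/eqP; rewrite eqn_leq -order_e -card_S smc_v_ge // andbT.
apply/bigmax_leqP=> c svmc; rewrite card_S.
have l_arc x y : e x y -> dist e a y <= (dist e a x).+1.
  by apply: dist_arc; move/forallP/(_ a)/forallP: strong_e.
have d_b : dist e a b = d by rewrite d_ab.
have := colors_le tour_e svmc l_arc (dist_self e a) d_b d_ge6 Omega_le.
by have := max_card (mem S); rewrite card_S; lia.
Qed.
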